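(* Let $(M,g)$ be a Riemannian $n$-manifold with curvature tensor $R_{pijk}$, and let $h$ be a local scalar field on $M$ (defined on an open subset) with $g^{ab}h_{;a}h_{;b}<1$ satisfying $$R_{pijk}=\frac{h_{;pj}h_{;ik}-h_{;pk}h_{;ij}}{1-g^{ab}h_{;a}h_{;b}}.$$ Then $$\Pi_{ab}=\frac{h_{;ab}}{(1-g^{mn}h_{;m}h_{;n})^{1/2}}$$ satisfies $R_{pijk}=\Pi_{pj}\Pi_{ik}-\Pi_{pk}\Pi_{ij}$ (Gauss equation) and $\Pi_{a[b;c]}=0$ (Codazzi equation).
   Context: All objects are smooth. '';'' is covariant differentiation with respect to the Levi-Civita connection of $g$; repeated upper/lower indices are summed; $\Pi_{a[b;c]}=\frac12(\Pi_{ab;c}-\Pi_{ac;b})$. Curvature sign convention: the unit round sphere has $R_{pijk}=g_{pj}g_{ik}-g_{pk}g_{ij}$. *)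

(* Defs.v *)
From HB Require Import structures.
From mathcomp Require Import all_boot all_order all_algebra.
From mathcomp Require Import all_classical all_reals all_analysis.
From mathcomp Require Import ring.

Set Implicit Arguments.
Unset Strict Implicit.
Unset Printing Implicit Defensive.

Import Order.TTheory GRing.Theory Num.Theory.
Import numFieldNormedType.Exports.

Local Open Scope classical_set_scope.
Local Open Scope ring_scope.

Definition pd (R : realType) (n : nat) (i : 'I_n) (f : 'rV[R]_n -> R)
    (x : 'rV[R]_n) : R :=
  'D_(delta_mx 0 i : 'rV[R]_n) f x.

(* Meant for open A, so that continuity and the partial derivatives at a point
   of A only depend on the values of f on A. *)
Fixpoint Ck_on (R : realType) (n k : nat) (A : set 'rV[R]_n)
    (f : 'rV[R]_n -> R) : Prop :=
  (forall x, A x -> {for x, continuous f}) /\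
  (if k is k'.+1 then
     forall i : 'I_n,
       (forall x, A x -> derivable f x (delta_mx 0 i : 'rV[R]_n)) /\
       Ck_on k' A (pd i f)
   else True).

Definition smooth_on (R : realType) (n : nat) (A : set 'rV[R]_n)
    (f : 'rV[R]_n -> R) : Prop :=
  forall k, Ck_on k A f.

(* The total functions chart_coord and chart_param matter only on chart_dom and
   on its image: they are mutually inverse homeomorphisms between these two
   open sets. *)
Record chart (R : realType) (n : nat) (M : topologicalType) := Chart {
  chart_dom : set M;
  chart_coord : M -> 'rV[R]_n;
  chart_param : 'rV[R]_n -> M;
  chart_dom_open : open chart_dom;
  chart_codom_open : open (chart_coord @` chart_dom);
  chart_coordK : forall p, chart_dom p -> chart_param (chart_coord p) = p;
  chart_coord_continuous : forall p, chart_dom p -> {for p, continuous chart_coord};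
  chart_param_continuous :
    forall x, (chart_coord @` chart_dom) x -> {for x, continuous chart_param} }.

Definition chart_image (R : realType) (n : nat) (M : topologicalType)
    (c : chart R n M) (U : set M) : set 'rV[R]_n :=
  chart_coord c @` (chart_dom c `&` U).

Definition transition (R : realType) (n : nat) (M : topologicalType)
    (c c' : chart R n M) (k : 'I_n) (x : 'rV[R]_n) : R :=
  chart_coord c' (chart_param c x) 0 k.

Definition compatible (R : realType) (n : nat) (M : topologicalType)
    (c c' : chart R n M) : Prop :=
  (forall k, smooth_on (chart_image c (chart_dom c')) (transition c c' k)) /\
  (forall k, smooth_on (chart_image c' (chart_dom c)) (transition c' c k)).

Record smooth_manifold (R : realType) (n : nat) := SmoothManifold {
  carrier :> topologicalType;
  carrier_hausdorff : hausdorff_space carrier;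
  carrier_second_countable : @second_countable carrier;
  atlas : set (chart R n carrier);
  atlas_cover : forall p, exists2 c, atlas c & chart_dom c p;
  atlas_compatible : forall c c', atlas c -> atlas c' -> compatible c c';
  atlas_maximal :
    forall c, (forall c', atlas c' -> compatible c c') -> atlas c }.

(* A metric is given by its component matrices in all charts of the maximal
   atlas, related by the transformation law of covariant 2-tensors. *)
Record riemannian_metric (R : realType) (n : nat) (M : smooth_manifold R n) :=
  RiemannianMetric {
  riem_comp :> chart R n M -> 'rV[R]_n -> 'M[R]_n;
  riem_smooth : forall c, atlas c -> forall i j,
    smooth_on (chart_coord c @` chart_dom c) (fun x => riem_comp c x i j);
  riem_sym : forall c, atlas c -> forall x, (chart_coord c @` chart_dom c) x ->
    forall i j, riem_comp c x i j = riem_comp c x j i;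
  riem_posdef : forall c, atlas c -> forall x, (chart_coord c @` chart_dom c) x ->
    forall v : 'rV[R]_n, v != 0 ->
      0 < \sum_i \sum_j riem_comp c x i j * v 0 i * v 0 j;
  riem_transform : forall c c', atlas c -> atlas c' ->
    forall p, chart_dom c p -> chart_dom c' p -> forall i j,
      riem_comp c (chart_coord c p) i j =
        \sum_k \sum_l riem_comp c' (chart_coord c' p) k l
          * pd i (transition c c' k) (chart_coord c p)
          * pd j (transition c c' l) (chart_coord c p) }.

Definition smooth_scalar (R : realType) (n : nat) (M : smooth_manifold R n)
    (U : set M) (h : M -> R) : Prop :=
  forall c, @atlas R n M c -> smooth_on (chart_image c U) (h \o chart_param c).

(* Below, g is the matrix (g_{ij}) of the metric in some chart, as a function
   of the coordinates; g^{ij} is the inverse matrix invmx (g x). *)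

(* christoffel g k i j is Gamma^k_{ij}. *)
Definition christoffel (R : realType) (n : nat) (g : 'rV[R]_n -> 'M[R]_n)
    (k i j : 'I_n) (x : 'rV[R]_n) : R :=
  2^-1 * \sum_l invmx (g x) k l *
    (pd i (fun y => g y j l) x + pd j (fun y => g y i l) x
     - pd l (fun y => g y i j) x).

(* f_{;a}, w_{a;b} and T_{ab;c}: the index of the derivative comes last. *)
Definition cov0 (R : realType) (n : nat) (f : 'rV[R]_n -> R) (a : 'I_n)
    (x : 'rV[R]_n) : R :=
  pd a f x.

Definition cov1 (R : realType) (n : nat) (g : 'rV[R]_n -> 'M[R]_n)
    (w : 'I_n -> 'rV[R]_n -> R) (a b : 'I_n) (x : 'rV[R]_n) : R :=
  pd b (w a) x - \sum_d christoffel g d b a x * w d x.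

Definition cov2 (R : realType) (n : nat) (g : 'rV[R]_n -> 'M[R]_n)
    (T : 'I_n -> 'I_n -> 'rV[R]_n -> R) (a b c : 'I_n) (x : 'rV[R]_n) : R :=
  pd c (T a b) x - \sum_d christoffel g d c a x * T d b x
                 - \sum_d christoffel g d c b x * T a d x.

Definition hess (R : realType) (n : nat) (g : 'rV[R]_n -> 'M[R]_n)
    (f : 'rV[R]_n -> R) (a b : 'I_n) (x : 'rV[R]_n) : R :=
  cov1 g (cov0 f) a b x.

(* The connection christoffel is the Levi-Civita connection: it is torsion-free
   (christoffelC) and g_{ij;k} = 0 (metric_parallel). *)

Lemma metric_pd_sym (R : realType) (n : nat) (M : smooth_manifold R n)
    (g : riemannian_metric M) (c : chart R n M) (x : 'rV[R]_n) :
  atlas c -> (chart_coord c @` chart_dom c) x -> forall i j l,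
    pd l (fun y => g c y i j) x = pd l (fun y => g c y j i) x.
Proof.
move=> cM cx i j l; apply: near_eq_derive.
apply: filterS (open_nbhs_nbhs (conj (@chart_codom_open _ _ _ c) cx)) => y cy.
exact: (riem_sym g cM cy).
Qed.

Lemma metric_unit (R : realType) (n : nat) (M : smooth_manifold R n)
    (g : riemannian_metric M) (c : chart R n M) (x : 'rV[R]_n) :
  atlas c -> (chart_coord c @` chart_dom c) x -> g c x \in unitmx.
Proof.
move=> cM cx; rewrite -row_free_unit -kermx_eq0; apply/eqP/row_matrixP => k.
rewrite row0; apply/eqP; apply: contraT => v0.
have := riem_posdef g cM cx v0; set v := row k _ in v0 *.
have vg : v *m g c x = 0 by apply/sub_kermxP; rewrite row_sub.
rewrite exchange_big /= big1 ?ltxx// => j _.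
under eq_bigr => i _ do rewrite [_ * v 0 i]mulrC.
by rewrite -mulr_suml; move/matrixP/(_ 0 j): vg; rewrite !mxE => ->; rewrite mul0r.
Qed.

Lemma christoffelC (R : realType) (n : nat) (M : smooth_manifold R n)
    (g : riemannian_metric M) (c : chart R n M) (x : 'rV[R]_n) :
  atlas c -> (chart_coord c @` chart_dom c) x -> forall k i j,
    christoffel (g c) k i j x = christoffel (g c) k j i x.
Proof.
move=> cM cx k i j; rewrite /christoffel; congr (_ * _).
apply: eq_bigr => l _; rewrite [pd l _ _](metric_pd_sym _ cM cx); ring.
Qed.

Lemma metric_parallel (R : realType) (n : nat) (M : smooth_manifold R n)
    (g : riemannian_metric M) (c : chart R n M) (x : 'rV[R]_n) :
  atlas c -> (chart_coord c @` chart_dom c) x -> forall i j k,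
    cov2 (g c) (fun i j y => g c y i j) i j k x = 0.
Proof.
move=> cM cx.
have low i j m : \sum_d christoffel (g c) d i j x * g c x m d =
    2^-1 * (pd i (fun y => g c y j m) x + pd j (fun y => g c y i m) x
            - pd m (fun y => g c y i j) x).
  rewrite /christoffel; under eq_bigr => d _ do rewrite -mulrA mulr_suml.
  rewrite -mulr_sumr exchange_big /=; congr (_ * _).
  set F := fun l => pd i (fun y => g c y j l) x + pd j (fun y => g c y i l) x
            - pd l (fun y => g c y i j) x.
  transitivity (\sum_l (1%:M : 'M[R]_n) m l * F l).
    apply: eq_bigr => l _; rewrite -(mulmxV (metric_unit g cM cx)) mxE mulr_suml.
    by apply: eq_bigr => d _; rewrite /F; ring.
  rewrite (bigD1 m)//= mxE eqxx mul1r big1 ?addr0// => l lm.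
  by rewrite mxE eq_sym (negbTE lm) mul0r.
move=> i j k; rewrite /cov2.
under eq_bigr => d _ do rewrite (riem_sym g cM cx).
rewrite !low.
rewrite (metric_pd_sym g cM cx j i k).
by field.
Qed.

(* R^l_{ijk}, with R(d_j, d_k) d_i = R^l_{ijk} d_l. *)
Definition curvature_up (R : realType) (n : nat) (g : 'rV[R]_n -> 'M[R]_n)
    (l i j k : 'I_n) (x : 'rV[R]_n) : R :=
  pd j (christoffel g l k i) x - pd k (christoffel g l j i) x
  + \sum_m (christoffel g l j m x * christoffel g m k i x
            - christoffel g l k m x * christoffel g m j i x).

(* R_{pijk} = g_{pl} R^l_{ijk}; the unit round sphere has
   R_{pijk} = g_{pj} g_{ik} - g_{pk} g_{ij}. *)
Definition curvature (R : realType) (n : nat) (g : 'rV[R]_n -> 'M[R]_n)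
    (p i j k : 'I_n) (x : 'rV[R]_n) : R :=
  \sum_l g x p l * curvature_up g l i j k x.

(* g^{ab} f_{;a} f_{;b} *)
Definition grad_sq (R : realType) (n : nat) (g : 'rV[R]_n -> 'M[R]_n)
    (f : 'rV[R]_n -> R) (x : 'rV[R]_n) : R :=
  \sum_a \sum_b invmx (g x) a b * cov0 f a x * cov0 f b x.

(* T_{a[b;c]} *)
Definition alt_cov2 (R : realType) (n : nat) (g : 'rV[R]_n -> 'M[R]_n)
    (T : 'I_n -> 'I_n -> 'rV[R]_n -> R) (a b c : 'I_n) (x : 'rV[R]_n) : R :=
  2^-1 * (cov2 g T a b c x - cov2 g T a c b x).

(* The tensor Pi_{ab} = f_{;ab} / (1 - g^{mn} f_{;m} f_{;n})^{1/2} *)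
Definition second_form (R : realType) (n : nat) (g : 'rV[R]_n -> 'M[R]_n)
    (f : 'rV[R]_n -> R) (a b : 'I_n) (x : 'rV[R]_n) : R :=
  hess g f a b x / Num.sqrt (1 - grad_sq g f x).

(* Main.v *)
Require Import Defs.
From HB Require Import structures.
From mathcomp Require Import all_boot all_order all_algebra.
From mathcomp Require Import all_classical all_reals all_analysis.
From mathcomp Require Import perm ring.
Import Order.TTheory GRing.Theory Num.Theory.
Import numFieldNormedType.Exports.
Local Open Scope classical_set_scope.
Local Open Scope ring_scope.

Set Implicit Arguments.
Unset Strict Implicit.

(** The Gauss equation is the hypothesis itself: the factor
    1 / (1 - |dh|^2) splits into the two factors (1 - |dh|^2)^(-1/2) carried
    by Pi.

    The Codazzi equation comes from a cancellation between a curvature term and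
    the derivative of the normalizing factor. Write s = (1 - |dh|^2)^(1/2), h^m for the gradient, and
    Q_c = h^m h_{;mc}. Since the metric is parallel, d_c |dh|^2 = 2 Q_c
    (is_derive_grad_sq), so that d_c (1/s) = Q_c / s^3 and
    Pi_{ab;c} = h_{;abc} / s + h_{;ab} Q_c / s^3 (cov2_scale).
    Hence Pi_{ab;c} - Pi_{ac;b} is
    (h_{;abc} - h_{;acb}) / s + (h_{;ab} Q_c - h_{;ac} Q_b) / s^3.
    The Ricci identity (ricci_identity, grad_curvature) gives
    h_{;abc} - h_{;acb} = h^m R_{mabc}, and the hypothesis on the curvature,
    contracted with h^m, turns this into (Q_b h_{;ac} - Q_c h_{;ab}) / s^2,
    which is exactly what cancels the other term.

    All of this is a computation in one chart at one point. The analysis behind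
    it is the symmetry of second partial derivatives (derive_comm), which the
    Ricci identity needs for the third derivatives of h, and the
    differentiation of the inverse metric (derive_invmx). *)

(** * Symmetry of second derivatives *)

Lemma is_derive_line (R : realType) (V : normedModType R) (f : V -> R)
    (a v : V) (t : R) : derivable f (t *: v + a) v ->
  is_derive t 1 (fun s : R => f (s *: v + a)) ('D_v f (t *: v + a)).
Proof.
move=> df.
have E : (fun h : R => h^-1 *: (f (h *: v + (t *: v + a)) - f (t *: v + a))) =
    (fun h => h^-1 *: (f ((h *: (1 : R) + t) *: v + a) - f (t *: v + a))).
  by apply/funext => h; rewrite [_ *: 1]mulr1 scalerDl addrA.
by split; rewrite /derive /derivable -E.
Qed.

Lemma mvt_line (R : realType) (V : normedModType R) (f : V -> R)
    (a v : V) (s : R) : 0 < s ->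
  (forall t, t \in `[0, s] -> derivable f (t *: v + a) v) ->
  exists2 t, t \in `[0, s] & f (s *: v + a) - f a = s * 'D_v f (t *: v + a).
Proof.
move=> s0 df.
have [||t] := @MVT_segment R (fun t => f (t *: v + a))
  (fun t => 'D_v f (t *: v + a)) 0 s (ltW s0).
- by move=> t ts; apply/is_derive_line/df; apply: subset_itv_oo_cc.
- apply: derivable_within_continuous => t ts.
  by case: (@is_derive_line _ _ f a v t (df t ts)) => + _; apply.
by rewrite scale0r add0r subr0 mulrC => ts ->; exists t.
Qed.

(** Two successive applications of the mean value theorem, first along u and
    then along v. The second difference on the left is symmetric in u and v up
    to the order of its terms, while the right-hand side is a value of one of
    the two mixed derivatives. *)
Lemma second_difference (R : realType) (V : normedModType R) (f : V -> R)
    (x u v : V) (s : R) : 0 < s ->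
  (forall a b, a \in `[0, s] -> b \in `[0, s] ->
    derivable f (a *: u + (b *: v + x)) u /\
    derivable ('D_u f) (a *: u + (b *: v + x)) v) ->
  exists a b, [/\ a \in `[0, s], b \in `[0, s] &
    f (s *: u + (s *: v + x)) - f (s *: u + x) - (f (s *: v + x) - f x) =
      s * (s * 'D_v ('D_u f) (a *: u + (b *: v + x)))].
Proof.
move=> s0 df.
have sin : s \in `[0, s] by rewrite in_itv/= lexx ltW.
have zin : 0 \in `[0, s] by rewrite in_itv/= lexx ltW.
pose F t := f (t *: u + (s *: v + x)) - f (t *: u + x).
have dF t : t \in `[0, s] -> is_derive t 1 F
    ('D_u f (t *: u + (s *: v + x)) - 'D_u f (t *: u + x)).
  move=> tin; apply: is_deriveB; apply: is_derive_line.
    exact: (df t s tin sin).1.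
  by have [+ _] := df t 0 tin zin; rewrite scale0r add0r; apply.
pose G (t : R) := 'D_u f (t *: u + (s *: v + x)) - 'D_u f (t *: u + x).
have dG t : t \in `]0, s[ -> is_derive t 1 F (G t).
  move=> ts; exact/dF/subset_itv_oo_cc.
have cF : {within `[0, s], continuous F}.
  by apply: derivable_within_continuous => t ts; case: (dF t ts) => + _; apply.
have [a ain] := MVT_segment (ltW s0) dG cF.
rewrite subr0 /F /G !scale0r !add0r => ->.
have [t tin|b bin] := @mvt_line _ _ ('D_u f) (a *: u + x) v s s0.
  by rewrite addrCA; have [_ +] := df a t ain tin; apply.
rewrite addrCA => ->; exists a, b; split => //.
by rewrite mulrC [b *: v + _]addrCA.
Qed.

(** Schwarz's theorem. By second_difference, the same small second difference
    is both s^2 times a value of D_v D_u f and s^2 times a value of D_u D_v f,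
    at two points near x; continuity at x then makes the two mixed derivatives
    at x arbitrarily close. *)
Lemma derive_comm (R : realType) (V : normedModType R) (f : V -> R)
    (x u v : V) :
  (\near x, derivable f x u) -> (\near x, derivable f x v) ->
  (\near x, derivable ('D_u f) x v) -> (\near x, derivable ('D_v f) x u) ->
  {for x, continuous ('D_v ('D_u f))} -> {for x, continuous ('D_u ('D_v f))} ->
  'D_v ('D_u f) x = 'D_u ('D_v f) x.
Proof.
move=> fu fv fuv fvu cuv cvu; apply/eqP; rewrite -subr_eq0 -normr_le0.
apply/ler_addgt0Pl => e e0; rewrite addr0.
have e2 : 0 < e / 2 by rewrite divr_gt0.
have /cvgrPdist_le/(_ _ e2) nuv := cuv.
have /cvgrPdist_le/(_ _ e2) nvu := cvu.
have [r /= r0 br] := (nbhs_ballP _ _).1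
  (filterI (filterI (filterI fu fv) (filterI fuv fvu)) (filterI nuv nvu)).
(* A parallelogram of sides s u and s v at x lies in the ball of radius r; the
   summand 1 makes k positive when u = v = 0. *)
pose k := `|u| + `|v| + 1.
have k0 : 0 < k by rewrite ltr_wpDl// addr_ge0.
pose s := r / 2 / k.
have s0 : 0 < s by rewrite !divr_gt0.
have inb a b : a \in `[0, s] -> b \in `[0, s] ->
    ball x r (a *: u + (b *: v + x)).
  rewrite !in_itv/= => /andP[a0 as_] /andP[b0 bs].
  rewrite -ball_normE /ball_ /= addrA opprD addrCA subrr addr0 normrN.
  apply: (@le_lt_trans _ _ (s * k)); last first.
    by rewrite /s divfK ?gt_eqF// ltr_pdivrMr// ltr_pMr// ltr1n.
  rewrite (le_trans (ler_normD _ _))// !normrZ !ger0_norm//.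
  rewrite /k !mulrDr mulr1 -[leLHS]addr0 lerD// ?(ltW s0)// lerD// ler_wpM2r//.
have [a [b [ain bin E1]]] := @second_difference _ _ f x u v s s0
  (fun a b ain bin => let: conj (conj (conj p _) (conj q _)) _ :=
     br _ (inb a b ain bin) in conj p q).
have inb' c d : c \in `[0, s] -> d \in `[0, s] ->
    ball x r (c *: v + (d *: u + x)).
  by move=> cin din; rewrite addrCA; exact: inb.
have [c [d [cin din E2]]] := @second_difference _ _ f x v u s s0
  (fun a b ain bin => let: conj (conj (conj _ p) (conj _ q)) _ :=
     br _ (inb' a b ain bin) in conj p q).
have E : 'D_v ('D_u f) (a *: u + (b *: v + x)) =
         'D_u ('D_v f) (c *: v + (d *: u + x)).
  have sN : s != 0 by rewrite gt_eqF.
  apply: (mulfI sN); apply: (mulfI sN).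
  apply: etrans (esym E1) (etrans _ E2).
  rewrite [s *: v + (_ + _)]addrCA -!addrA; congr (_ + _).
  by rewrite !opprB addrCA [RHS]addrCA (addrC (- f _)).
have [_ [h1 _]] := br _ (inb a b ain bin).
have [_ [_ h2]] := br _ (inb' c d cin din).
rewrite -(subrKA ('D_v ('D_u f) (a *: u + (b *: v + x)))) {2}E.
rewrite (splitr e); apply: le_trans (ler_normD _ _) _.
by apply: lerD; [exact: h1 | rewrite distrC; exact: h2].
Qed.

(** * Directional derivatives of products, determinants and inverse matrices *)

Lemma is_derive_mul (R : realType) (V : normedModType R) (x v : V)
    (f g : V -> R) (df dg : R) : is_derive x v f df -> is_derive x v g dg ->
  is_derive x v (fun y => f y * g y) (df * g x + f x * dg).
Proof.
move=> hf hg; apply: (is_derive_eq (is_deriveM hf hg)).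
by rewrite addrC [g x *: df]mulrC.
Qed.

Lemma is_derive_bigsum (R : realType) (V : normedModType R) (I : finType)
    (x v : V) (h : I -> V -> R) (dh : I -> R) :
  (forall i, is_derive x v (h i) (dh i)) ->
  is_derive x v (fun y => \sum_i h i y) (\sum_i dh i).
Proof.
move=> hdh; have -> : (fun y => \sum_i h i y) = \sum_i h i.
  by apply/funext => y; rewrite fct_sumE.
apply: (big_rec2 (fun (f : V -> R) df => is_derive x v f df)).
  exact: is_derive_cst.
by move=> i f df _; apply: is_deriveD.
Qed.

Lemma derivable_bigprod (R : realType) (V : normedModType R) (I : finType)
    (x v : V) (h : I -> V -> R) : (forall i, derivable (h i) x v) ->
  derivable (fun y => \prod_i h i y) x v.
Proof.
move=> dh; elim: (index_enum I) => [|i r dr].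
  under eq_fun do rewrite big_nil.
  exact: derivable_cst.
under eq_fun do rewrite big_cons.
exact: (derivableM (dh i) dr).
Qed.

Lemma is_derive_scalar_comp (R : realType) (V : normedModType R) (x v : V)
    (f : V -> R) (phi : R -> R) (df dphi : R) :
  is_derive x v f df -> is_derive (f x) 1 phi dphi ->
  is_derive x v (fun y => phi (f y)) (dphi * df).
Proof.
move=> [hf <-] [hphi <-].
pose F (t : R) := f (t *: v + x).
have F0 : F 0 = f x by rewrite /F scale0r add0r.
have line (G : V -> R) : 'D_v G x = 'D_1 (fun t : R => G (t *: v + x)) 0.
  rewrite /derive; set g1 := fun t => t^-1 *: _; set g2 := fun t => t^-1 *: _.
  suff -> : g1 = g2 by []; apply/funext => t; rewrite /g1 /g2 /=.
  by rewrite addr0 scale0r add0r [_%:A]mulr1.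
have dF : derivable F 0 1 := (derivable1P f x v).1 hf.
have dphi' : derivable phi (F 0) 1 by rewrite F0; exact: hphi.
split.
  apply: (derivable1P (fun y => phi (f y)) x v).2.
  apply/derivable1_diffP/(@differentiable_comp _ _ _ _ F phi).
    exact: (derivable1_diffP F 0).1 dF.
  exact: (derivable1_diffP phi (F 0)).1 dphi'.
rewrite (line (fun y => phi (f y))) -derive1E (derive1_comp dF dphi').
by rewrite !derive1E F0 -line.
Qed.

Lemma derivable_det (R : realType) (V : normedModType R) (n : nat) (x v : V)
    (A : V -> 'M[R]_n) : (forall i j, derivable (fun y => A y i j) x v) ->
  derivable (fun y => \det (A y)) x v.
Proof.
move=> dA.
suff : is_derive x v (fun y => \det (A y))
  (\sum_(s : 'S_n) 'D_v (fun y => (-1) ^+ s * \prod_i A y i (s i)) x) by [].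
apply: is_derive_bigsum => s; apply/derivableP.
apply: (@derivableM _ _ (cst ((-1) ^+ s)) (fun y => \prod_i A y i (s i))).
  exact: derivable_cst.
exact: (@derivable_bigprod _ _ _ x v (fun i y => A y i (s i))).
Qed.

(** Near x the inverse is given by Cramer's rule, whose cofactors are
    determinants. *)
Lemma derivable_invmx (R : realType) (V : normedModType R) (n : nat) (x v : V)
    (A : V -> 'M[R]_n) : (\near x, A x \in unitmx) ->
  (forall i j, derivable (fun y => A y i j) x v) ->
  forall i j, derivable (fun y => invmx (A y) i j) x v.
Proof.
move=> Au dA i j.
have Ax : \det (A x) != 0 by rewrite -unitfE; exact: (nbhs_singleton Au).
apply: (@near_eq_derivable _ _ _
  (fun y => (\det (A y))^-1 * ((-1) ^+ (j + i)
     * \det (row' j (col' i (A y)))))).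
  by apply: filterS Au => y Ay; rewrite /invmx Ay !mxE.
apply: (@derivableM _ _ (fun y => (\det (A y))^-1)).
  exact: (@derivableV _ _ (fun y => \det (A y)) _ _ Ax (derivable_det dA)).
apply: (@derivableM _ _ (cst ((-1) ^+ (j + i))) (fun y => \det (row' j (col' i (A y))))).
  exact: derivable_cst.
apply: derivable_det => k l.
under eq_fun do rewrite !mxE.
exact: dA.
Qed.

(** Differentiating the constant A A^-1 = 1 by the product rule and solving for
    the derivative of A^-1. *)
Lemma derive_invmx (R : realType) (V : normedModType R) (n : nat) (x v : V)
    (A : V -> 'M[R]_n) : (\near x, A x \in unitmx) ->
  (forall i j, derivable (fun y => A y i j) x v) ->
  \matrix_(i, j) 'D_v (fun y => invmx (A y) i j) x =
  - (invmx (A x) *m (\matrix_(i, j) 'D_v (fun y => A y i j) x) *m invmx (A x)).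
Proof.
move=> Au dA; set dI := LHS; set dAx := (X in _ *m X *m _).
have Ax := nbhs_singleton Au.
have dI' := derivable_invmx Au dA.
suff E : dAx *m invmx (A x) + A x *m dI = 0.
  move/eqP: E; rewrite addrC addr_eq0 => /eqP E.
  by rewrite -mulmxA -mulmxN -E mulKmx.
apply/matrixP => i j; rewrite !mxE -big_split /=.
have D : is_derive x v (fun y => \sum_k A y i k * invmx (A y) k j)
    (\sum_k (dAx i k * invmx (A x) k j + A x i k * dI k j)).
  apply: (@is_derive_bigsum _ _ _ _ _ (fun k y => A y i k * invmx (A y) k j)).
  move=> k; rewrite !mxE; apply: (is_derive_mul); exact/derivableP.
rewrite -(@derive_val _ _ _ _ _ _ _ D).
rewrite -[RHS](derive_cst ((i == j)%:R : R) x v).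
apply: near_eq_derive; apply: filterS Au => y Ay.
by have := mulmxV Ay => /matrixP/(_ i j); rewrite !mxE.
Qed.

(** * Partial derivatives of smooth functions *)

Lemma Ck_on_subset (R : realType) (n k : nat) (A B : set 'rV[R]_n)
    (f : 'rV[R]_n -> R) : B `<=` A -> Ck_on k A f -> Ck_on k B f.
Proof.
move=> BA; elim: k f => [|k IH] f [cf df]; split.
- by move=> x /BA; exact: cf.
- by [].
- by move=> x /BA; exact: cf.
- by move=> i; have [di Di] := df i; split => [x /BA|]; [exact: di|exact: IH].
Qed.

Lemma smooth_on_pd (R : realType) (n : nat) (A : set 'rV[R]_n)
    (f : 'rV[R]_n -> R) (i : 'I_n) : smooth_on A f -> smooth_on A (pd i f).
Proof. by move=> fA k; have [_ /(_ i)[]] := fA k.+1. Qed.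

Lemma smooth_on_is_derive (R : realType) (n : nat) (A : set 'rV[R]_n)
    (f : 'rV[R]_n -> R) (i : 'I_n) (x : 'rV[R]_n) : smooth_on A f -> A x ->
  is_derive x (delta_mx 0 i : 'rV[R]_n) f (pd i f x).
Proof.
by move=> /(_ 1%N)[_ /(_ i)[df _]] Ax; apply: DeriveDef => //; exact: df.
Qed.

Lemma pd_comm (R : realType) (n : nat) (A : set 'rV[R]_n)
    (f : 'rV[R]_n -> R) (i j : 'I_n) (x : 'rV[R]_n) :
  open A -> smooth_on A f -> A x -> pd i (pd j f) x = pd j (pd i f) x.
Proof.
move=> Ao fA Ax.
have nA : \near x, A x by exact: open_nbhs_nbhs.
have dA (f' : 'rV[R]_n -> R) k : smooth_on A f' ->
    \near x, derivable f' x (delta_mx 0 k : 'rV[R]_n).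
  move=> f'A; apply: filterS nA => y Ay.
  by case: (smooth_on_is_derive k f'A Ay) => + _; apply.
have fi := smooth_on_pd i fA; have fj := smooth_on_pd j fA.
apply: derive_comm; [exact: dA|exact: dA|exact: dA|exact: dA| |].
  exact: (smooth_on_pd i fj 0%N).1.
exact: (smooth_on_pd j fi 0%N).1.
Qed.

(** * Third covariant derivatives and the Ricci identity *)

Lemma is_derive_christoffel (R : realType) (n : nat) (A : set 'rV[R]_n)
    (g : 'rV[R]_n -> 'M[R]_n) (x : 'rV[R]_n) (k i j c : 'I_n) :
  open A -> (forall i j, smooth_on A (fun y => g y i j)) ->
  (forall y, A y -> g y \in unitmx) -> A x ->
  is_derive x (delta_mx 0 c : 'rV[R]_n) (christoffel g k i j)
    (pd c (christoffel g k i j) x).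
Proof.
move=> Ao gA gu Ax; apply/derivableP.
have gn : \near x, g x \in unitmx.
  by apply: filterS (open_nbhs_nbhs (conj Ao Ax)) => y; exact: gu.
have dI a b : derivable (fun y => invmx (g y) a b) x (delta_mx 0 c : 'rV[R]_n).
  apply: derivable_invmx => // i' j'.
  by case: (smooth_on_is_derive c (gA i' j') Ax) => + _; apply.
have dg m a b : derivable (pd m (fun y => g y a b)) x (delta_mx 0 c : 'rV[R]_n).
  by case: (smooth_on_is_derive c (smooth_on_pd m (gA a b)) Ax)
    => + _; apply.
apply: (@derivableM _ _ (cst 2^-1) (fun y => \sum_l invmx (g y) k l *
    (pd i (fun y => g y j l) y + pd j (fun y => g y i l) y
     - pd l (fun y => g y i j) y))); first exact: derivable_cst.
apply: ex_derive; apply: (@is_derive_bigsum _ _ _ _ _ (fun l y => invmx (g y) k l *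
    (pd i (fun y => g y j l) y + pd j (fun y => g y i l) y
     - pd l (fun y => g y i j) y))) => l.
apply/derivableP; apply: (derivableM (dI k l)).
exact: derivableB (derivableD (dg i j l) (dg j i l)) (dg l i j).
Qed.

Lemma is_derive_hess (R : realType) (n : nat) (A : set 'rV[R]_n)
    (g : 'rV[R]_n -> 'M[R]_n) (f : 'rV[R]_n -> R) (x : 'rV[R]_n)
    (a b c : 'I_n) :
  open A -> (forall i j, smooth_on A (fun y => g y i j)) ->
  (forall y, A y -> g y \in unitmx) -> smooth_on A f -> A x ->
  is_derive x (delta_mx 0 c : 'rV[R]_n) (hess g f a b)
    (pd c (pd b (pd a f)) x -
     \sum_d (pd c (christoffel g d b a) x * pd d f x
             + christoffel g d b a x * pd c (pd d f) x)).
Proof.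
move=> Ao gA gu fA Ax; apply: is_deriveB.
  by apply: smooth_on_is_derive Ax; do 2 apply: smooth_on_pd.
apply: (@is_derive_bigsum _ _ _ _ _ (fun d y => christoffel g d b a y * pd d f y)).
move=> d; apply: is_derive_mul; first exact: is_derive_christoffel Ax.
by apply: smooth_on_is_derive Ax; apply: smooth_on_pd.
Qed.

(** f_{;abc} - f_{;acb} = R^l_{abc} f_{;l}. Expanding the covariant derivatives,
    the third partial derivatives of f cancel by Schwarz's theorem, the
    Christoffel term on the index b (resp. c) by torsion-freeness, and the terms
    with second partial derivatives of f pairwise; what is left is, coefficient
    by coefficient, the coordinate expression of the curvature. *)
Lemma ricci_identity (R : realType) (n : nat) (A : set 'rV[R]_n)
    (g : 'rV[R]_n -> 'M[R]_n) (f : 'rV[R]_n -> R) (x : 'rV[R]_n) :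
  open A -> (forall i j, smooth_on A (fun y => g y i j)) ->
  (forall y, A y -> g y \in unitmx) -> smooth_on A f -> A x ->
  (forall k i j, christoffel g k i j x = christoffel g k j i x) ->
  forall a b c,
  cov2 g (hess g f) a b c x - cov2 g (hess g f) a c b x =
    \sum_l curvature_up g l a b c x * pd l f x.
Proof.
move=> Ao gA gu fA Ax torsion_free a b c.
pose G l i j := christoffel g l i j x.
(* In f_{;abc}, S1 b c and S2 b c come from differentiating the Christoffel
   term of f_{;ab}, S2 c b and S3 c b from the correction for the index a, and
   S4 b c from the correction for the index b. *)
pose S1 b c := \sum_d pd c (christoffel g d b a) x * pd d f x.
pose S2 b c := \sum_d G d b a * pd c (pd d f) x.
pose S3 b c := \sum_m \sum_d G m c d * G d b a * pd m f x.
pose S4 b c := \sum_d G d c b * hess g f a d x.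
have expand b' c' : cov2 g (hess g f) a b' c' x =
    pd c' (pd b' (pd a f)) x - (S1 b' c' + S2 b' c') - (S2 c' b' - S3 c' b')
    - S4 b' c'.
  rewrite /cov2; congr (_ - _ - _).
    rewrite {1}/pd (@derive_val _ _ _ _ _ _ _
      (is_derive_hess a b' c' Ao gA gu fA Ax)).
    by rewrite big_split.
  rewrite /S3 exchange_big /= -sumrB; apply: eq_bigr => d _.
  rewrite /hess /cov1 mulrBr mulr_sumr; congr (_ - _).
  by apply: eq_bigr => m _; rewrite /G /cov0; ring.
have -> : \sum_l curvature_up g l a b c x * pd l f x =
    S1 c b - S1 b c + (S3 c b - S3 b c).
  rewrite -!sumrB -big_split /=; apply: eq_bigr => l _.
  rewrite /curvature_up mulrDl mulrBl; congr (_ + _).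
  by rewrite mulr_suml -sumrB; apply: eq_bigr => m _; rewrite mulrBl.
have E4 : S4 b c = S4 c b.
  by apply: eq_bigr => d _; rewrite /G torsion_free.
have E0 : pd c (pd b (pd a f)) x = pd b (pd c (pd a f)) x.
  exact: pd_comm Ao (smooth_on_pd a fA) Ax.
rewrite !expand E4 E0; move: (pd b _ x) (S1 b c) (S1 c b) (S2 b c) (S2 c b).
move: (S3 b c) (S3 c b) (S4 c b) => s3 s3' s4 p s1 s1' s2 s2'; clear; ring.
Qed.

(** * The gradient *)

(** f^{;m}, the index of f_{;l} being raised on the right: this is the row vector
    of the f_{;l} multiplied by the inverse matrix of the metric. *)
Definition grad (R : realType) (n : nat) (g : 'rV[R]_n -> 'M[R]_n)
    (f : 'rV[R]_n -> R) (m : 'I_n) (x : 'rV[R]_n) : R :=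
  \sum_l cov0 f l x * invmx (g x) l m.

(** The coordinate form of g^{ij}_{;c} = 0: g_{ij;c} = 0 says that the derivative
    of the matrix g is C g + g C^T, and conjugating by g^-1 as in derive_invmx
    removes one factor g from each term. *)
Lemma pd_invmx_metric (R : realType) (n : nat) (g : 'rV[R]_n -> 'M[R]_n)
    (x : 'rV[R]_n) (c : 'I_n) :
  (\near x, g x \in unitmx) ->
  (forall i j, derivable (fun y => g y i j) x (delta_mx 0 c : 'rV[R]_n)) ->
  (forall i j, cov2 g (fun i j y => g y i j) i j c x = 0) ->
  let C := \matrix_(p, d) christoffel g d c p x in
  \matrix_(i, j) pd c (fun y => invmx (g y) i j) x =
    - (invmx (g x) *m C + C^T *m invmx (g x)).
Proof.
move=> gu dg parallel C.
rewrite [LHS]derive_invmx//; congr (- _).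
have gx := nbhs_singleton gu.
have -> : \matrix_(i, j) 'D_(delta_mx 0 c : 'rV[R]_n) (fun y => g y i j) x =
    C *m g x + g x *m C^T.
  apply/matrixP => i j; have /eqP := parallel i j.
  rewrite !mxE /cov2 -addrA -opprD subr_eq0 => /eqP; rewrite /pd => ->.
  congr (_ + _); apply: eq_bigr => d _; rewrite !mxE//; exact: mulrC.
rewrite mulmxDr mulmxDl mulmxA -mulmxA mulmxV// mulmx1.
by rewrite mulmxA mulVmx// mul1mx.
Qed.

Lemma bilinear_sumE (R : realType) (n : nat) (M : 'M[R]_n) (u v : 'rV[R]_n) :
  (u *m M *m v^T) 0 0 = \sum_a \sum_b M a b * u 0 a * v 0 b.
Proof.
rewrite exchange_big !mxE; apply: eq_bigr => b _; rewrite !mxE mulr_suml.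
by apply: eq_bigr => a _; rewrite [u _ _ * _]mulrC.
Qed.

(** d_c |df|^2 = 2 f^{;m} f_{;mc}. In matrix form |df|^2 = w I w^T with I = g^-1
    and w the row of the first derivatives. The product rule gives three terms,
    and the two terms of dI supplied by pd_invmx_metric are precisely the
    Christoffel corrections which turn the two occurrences of the partial
    derivative of w into the column c of the Hessian. *)
Lemma is_derive_grad_sq (R : realType) (n : nat) (A : set 'rV[R]_n)
    (g : 'rV[R]_n -> 'M[R]_n) (f : 'rV[R]_n -> R) (x : 'rV[R]_n) (c : 'I_n) :
  open A -> (forall i j, smooth_on A (fun y => g y i j)) ->
  (forall y, A y -> g y \in unitmx) -> smooth_on A f -> A x ->
  (forall i j, g x i j = g x j i) ->
  (forall i j, cov2 g (fun i j y => g y i j) i j c x = 0) ->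
  is_derive x (delta_mx 0 c : 'rV[R]_n) (grad_sq g f)
    (2 * \sum_m grad g f m x * hess g f m c x).
Proof.
move=> Ao gA gu fA Ax gsym parallel.
have gn : \near x, g x \in unitmx.
  by apply: filterS (open_nbhs_nbhs (conj Ao Ax)) => y; exact: gu.
have dg i j : derivable (fun y => g y i j) x (delta_mx 0 c : 'rV[R]_n).
  by case: (smooth_on_is_derive c (gA i j) Ax) => + _; apply.
have dI i j : is_derive x (delta_mx 0 c : 'rV[R]_n) (fun y => invmx (g y) i j)
    (pd c (fun y => invmx (g y) i j) x).
  exact/derivableP/derivable_invmx.
have dw a : is_derive x (delta_mx 0 c : 'rV[R]_n) (pd a f) (pd c (pd a f) x).
  by apply: smooth_on_is_derive Ax; apply: smooth_on_pd.
pose w : 'rV[R]_n := \row_a pd a f x.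
pose w' : 'rV[R]_n := \row_a pd c (pd a f) x.
pose G := g x; pose I := invmx G.
pose I' : 'M[R]_n := \matrix_(i, j) pd c (fun y => invmx (g y) i j) x.
pose C : 'M[R]_n := \matrix_(p, d) christoffel g d c p x.
pose H : 'rV[R]_n := \row_m hess g f m c x.
have HE : H = w' - w *m C^T.
  apply/rowP => m; rewrite !mxE /hess /cov1; congr (_ - _).
  by apply: eq_bigr => d _; rewrite !mxE mulrC.
have IT : I^T = I.
  by rewrite /I trmx_inv; congr (invmx _); apply/matrixP => i j; rewrite mxE gsym.
have D : is_derive x (delta_mx 0 c : 'rV[R]_n) (grad_sq g f)
    (\sum_a \sum_b ((I' a b * w 0 a + I a b * w' 0 a) * w 0 b
                    + I a b * w 0 a * w' 0 b)).
  apply: (@is_derive_bigsum _ _ _ _ _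
    (fun a y => \sum_b invmx (g y) a b * cov0 f a y * cov0 f b y)) => a.
  apply: (@is_derive_bigsum _ _ _ _ _
    (fun b y => invmx (g y) a b * cov0 f a y * cov0 f b y)) => b.
  rewrite !mxE; exact: is_derive_mul (is_derive_mul (dI a b) (dw a)) (dw b).
apply: is_derive_eq D _.
transitivity ((w *m I' *m w^T + w' *m I *m w^T + w *m I *m w'^T) 0 0).
  rewrite [RHS]mxE [in RHS]mxE !bilinear_sumE -!big_split /=.
  apply: eq_bigr => a _; rewrite -!big_split /=; apply: eq_bigr => b _.
  by rewrite mulrDl.
have -> : \sum_m grad g f m x * hess g f m c x = (w *m I *m H^T) 0 0.
  rewrite [RHS]mxE; apply: eq_bigr => m _; rewrite !mxE; congr (_ * _).
  by apply: eq_bigr => l _; rewrite !mxE.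
have HI : (w *m I *m H^T) 0 0 = (H *m I *m w^T) 0 0.
  transitivity ((w *m I *m H^T)^T 0 0); first by rewrite [RHS]mxE.
  by rewrite !trmx_mul trmxK IT mulmxA.
transitivity ((w *m I *m H^T + H *m I *m w^T) 0 0); last first.
  by rewrite [LHS]mxE -HI mulr_natl mulr2n.
have -> : I' = - (I *m C + C^T *m I) by exact: pd_invmx_metric gn dg parallel.
rewrite HE; clearbody I C w w'; clear; congr (fun_of_matrix _ 0 0).
have -> : (w' - w *m C^T)^T = w'^T - C *m w^T.
  by apply/colP => i; rewrite -[C]trmxK -trmx_mul trmxK !mxE.
rewrite mulmxBr !mulmxBl.
rewrite mulmxN mulNmx mulmxDr mulmxDl !mulmxA.
move: (w *m I *m C *m _) (w *m C^T *m _ *m _) (w' *m _ *m _) (w *m I *m _).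
move=> P Q S T.
by rewrite opprD -(addrA (- P)) [LHS]addrC [LHS]addrA [- Q + S]addrC.
Qed.

(** Both sides are the row of the f_{;l} times the column of the R^l_{ijk}, on
    the right with g^-1 g = 1 inserted in between. *)
Lemma grad_curvature (R : realType) (n : nat) (g : 'rV[R]_n -> 'M[R]_n)
    (f : 'rV[R]_n -> R) (x : 'rV[R]_n) (i j k : 'I_n) : g x \in unitmx ->
  \sum_l curvature_up g l i j k x * pd l f x =
    \sum_m grad g f m x * curvature g m i j k x.
Proof.
move=> gu; pose w : 'rV[R]_n := \row_a pd a f x.
pose K : 'cV[R]_n := \col_l curvature_up g l i j k x.
transitivity ((w *m K) 0 0).
  by rewrite mxE; apply: eq_bigr => l _; rewrite !mxE mulrC.
have -> : w *m K = (w *m invmx (g x)) *m (g x *m K) by rewrite -mulmxA mulKmx.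
rewrite mxE; apply: eq_bigr => m _.
rewrite !mxE /grad /curvature; congr (_ * _); apply: eq_bigr => l _.
  by rewrite mxE.
by rewrite mxE.
Qed.

(** * The Gauss and Codazzi equations *)

Lemma cov2_scale (R : realType) (n : nat) (g : 'rV[R]_n -> 'M[R]_n)
    (T : 'I_n -> 'I_n -> 'rV[R]_n -> R) (phi : 'rV[R]_n -> R) (dphi : R)
    (x : 'rV[R]_n) (a b c : 'I_n) :
  derivable (T a b) x (delta_mx 0 c : 'rV[R]_n) ->
  is_derive x (delta_mx 0 c : 'rV[R]_n) phi dphi ->
  cov2 g (fun a b y => T a b y * phi y) a b c x =
    cov2 g T a b c x * phi x + T a b x * dphi.
Proof.
move=> /derivableP dT dphix; rewrite /cov2 {1}/pd.
rewrite (@derive_val _ _ _ _ _ _ _ (is_derive_mul dT dphix)).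
rewrite !mulrBl !mulr_suml.
under [X in _ = _ - X - _ + _]eq_bigr do rewrite -mulrA.
under [X in _ = _ - X + _]eq_bigr do rewrite -mulrA.
by rewrite -[RHS]addrAC; congr (_ - _); rewrite [RHS]addrAC.
Qed.

(** The derivative of f is written 2 df to match is_derive_grad_sq; this 2 cancels
    the one from the square root. *)
Lemma is_derive_inv_sqrt (R : realType) (V : normedModType R) (x v : V)
    (f : V -> R) (df : R) : f x < 1 ->
  is_derive x v f (2 * df) ->
  is_derive x v (fun y => (Num.sqrt (1 - f y))^-1) (df / Num.sqrt (1 - f x) ^+ 3).
Proof.
move=> fx dfx; have D0 : 0 < 1 - f x by rewrite subr_gt0.
have s0 : Num.sqrt (1 - f x) != 0 by rewrite gt_eqF// sqrtr_gt0.
have dD : is_derive x v (fun y => 1 - f y) (0 - 2 * df).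
  by apply: is_deriveB.
have ds := is_derive_scalar_comp dD (is_derive1_sqrt D0).
have [ds' dsE] := ds.
pose S y := Num.sqrt (1 - f y).
have dV := @derivableV _ _ S x v s0 ds'.
have dVE := @deriveV _ _ S x v s0 ds'.
apply: (DeriveDef dV); rewrite dVE dsE /S.
move: (Num.sqrt _) s0 => s s0; rewrite /GRing.scale /=; clear -s0; by field.
Qed.

(** Near the image of a point of U, the chart image of U is the preimage of U by
    the continuous parametrization. *)
Lemma chart_image_open (R : realType) (n : nat) (M : topologicalType)
    (c : chart R n M) (U : set M) : open U -> open (chart_image c U).
Proof.
move=> Uo; rewrite openE => _ [p [dp Up] <-].
have cx : (chart_coord c @` chart_dom c) (chart_coord c p) by exists p.
have nU : nbhs (chart_coord c p) (chart_param c @^-1` U).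
  apply: (chart_param_continuous cx); rewrite /nbhs/= chart_coordK//.
  exact: open_nbhs_nbhs.
have nC := open_nbhs_nbhs (conj (@chart_codom_open _ _ _ c) cx).
apply: filterS (filterI nU nC) => y [Uy [q dq qy]].
by exists q => //; split=> //; move: Uy; rewrite /preimage/= -qy chart_coordK.
Qed.

Lemma gauss_second_form (R : realType) (n : nat) (g : 'rV[R]_n -> 'M[R]_n)
    (f : 'rV[R]_n -> R) (x : 'rV[R]_n) : grad_sq g f x < 1 ->
  let Pi := second_form g f in forall p i j k,
  (hess g f p j x * hess g f i k x - hess g f p k x * hess g f i j x)
    / (1 - grad_sq g f x) = Pi p j x * Pi i k x - Pi p k x * Pi i j x.
Proof.
move=> lt1 Pi p i j k; rewrite /Pi /second_form.
have D0 : 0 < 1 - grad_sq g f x by rewrite subr_gt0.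
rewrite -{1}(sqr_sqrtr (ltW D0)).
have : Num.sqrt (1 - grad_sq g f x) != 0 by rewrite gt_eqF// sqrtr_gt0.
move: (Num.sqrt _) (hess _ _ p j x) (hess _ _ i k x) (hess _ _ p k x)
  (hess _ _ i j x) => s a b d e s0; clear -s0; by field.
Qed.

(** Stated for a matrix of functions g on an open set A of coordinates, the
    symmetry of g and the two defining properties of its Levi-Civita connection
    being assumed at the point x alone; the cancellation is the one described at
    the top. *)
Lemma codazzi_second_form (R : realType) (n : nat) (A : set 'rV[R]_n)
    (g : 'rV[R]_n -> 'M[R]_n) (f : 'rV[R]_n -> R) (x : 'rV[R]_n) :
  open A -> (forall i j, smooth_on A (fun y => g y i j)) ->
  (forall y, A y -> g y \in unitmx) -> smooth_on A f -> A x ->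
  (forall i j, g x i j = g x j i) ->
  (forall k i j, christoffel g k i j x = christoffel g k j i x) ->
  (forall i j k, cov2 g (fun i j y => g y i j) i j k x = 0) ->
  grad_sq g f x < 1 ->
  (forall p i j k, curvature g p i j k x =
    (hess g f p j x * hess g f i k x - hess g f p k x * hess g f i j x)
      / (1 - grad_sq g f x)) ->
  forall a b c, alt_cov2 g (second_form g f) a b c x = 0.
Proof.
move=> Ao gA gu fA Ax gsym torsion_free parallel lt1 curvE a b c.
have D0 : 0 < 1 - grad_sq g f x by rewrite subr_gt0.
pose s := Num.sqrt (1 - grad_sq g f x).
have s0 : s != 0 by rewrite gt_eqF// sqrtr_gt0.
pose Q d := \sum_m grad g f m x * hess g f m d x.
have covPi d e : cov2 g (second_form g f) a d e x =
    cov2 g (hess g f) a d e x / s + hess g f a d x * (Q e / s ^+ 3).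
  apply: (@cov2_scale _ _ g (hess g f)
    (fun y => (Num.sqrt (1 - grad_sq g f y))^-1)).
    by case: (is_derive_hess a d e Ao gA gu fA Ax) => + _; apply.
  apply: (is_derive_inv_sqrt lt1).
  exact: is_derive_grad_sq Ao gA gu fA Ax gsym (fun i j => parallel i j e).
have ricci : cov2 g (hess g f) a b c x - cov2 g (hess g f) a c b x =
    (Q b * hess g f a c x - Q c * hess g f a b x) / s ^+ 2.
  rewrite (ricci_identity Ao gA gu fA Ax torsion_free) grad_curvature; last exact: gu.
  rewrite /Q !mulr_suml -sumrB mulr_suml; apply: eq_bigr => m _.
  rewrite curvE /s sqr_sqrtr ?ltW// !mulrA; congr (_ / _).
  by rewrite mulrBr !mulrA.
have {}ricci : cov2 g (hess g f) a b c x = cov2 g (hess g f) a c b x +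
    (Q b * hess g f a c x - Q c * hess g f a b x) / s ^+ 2.
  by rewrite -ricci addrC subrK.
rewrite /alt_cov2 !covPi ricci; clear covPi ricci.
move: (cov2 _ _ _ _ _ _) (Q b) (Q c) (hess _ _ a b x) (hess _ _ a c x) s s0.
by move=> t qb qc hb hc s s0; clear -s0; field.
Qed.

Unset Implicit Arguments.
Set Strict Implicit.

Theorem lemma3p2 (R : realType) (n : nat) (M : smooth_manifold R n)
    (g : riemannian_metric M) (U : set M) (h : M -> R)
    (U_open : open U) (h_smooth : smooth_scalar U h)
    (grad_lt1 : forall c : chart R n M, atlas c ->
       forall x, chart_image c U x -> grad_sq (g c) (h \o chart_param c) x < 1)
    (curvature_eq : forall c : chart R n M, atlas c ->
       forall x, chart_image c U x -> forall p i j k : 'I_n,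
         curvature (g c) p i j k x =
           (hess (g c) (h \o chart_param c) p j x * hess (g c) (h \o chart_param c) i k x
            - hess (g c) (h \o chart_param c) p k x * hess (g c) (h \o chart_param c) i j x)
           / (1 - grad_sq (g c) (h \o chart_param c) x)) :
  forall c : chart R n M, atlas c ->
    let Pi := second_form (g c) (h \o chart_param c) in
    forall x, chart_image c U x ->
      (forall p i j k : 'I_n,
         curvature (g c) p i j k x = Pi p j x * Pi i k x - Pi p k x * Pi i j x)
      /\ (forall a b d : 'I_n, alt_cov2 (g c) Pi a b d x = 0).
Proof.
move=> c cM Pi x cUx.
have sub : chart_image c U `<=` chart_coord c @` chart_dom c.
  by move=> _ [p [dp _] <-]; exists p.
have cx := sub _ cUx; have lt1 := grad_lt1 c cM x cUx.
split=> [p i j k|].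
  by rewrite curvature_eq// gauss_second_form.
apply: (@codazzi_second_form _ _ (chart_image c U)) => //.
- exact: chart_image_open.
- by move=> i j k; apply: (Ck_on_subset sub); exact: riem_smooth.
- by move=> y /sub cy; exact: metric_unit.
- exact: h_smooth.
- exact: riem_sym.
- exact: christoffelC.
- exact: metric_parallel.
- exact: curvature_eq.
Qed.
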